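(* Let $l\ge 2$ be an integer and let $w\geq 2$ be an odd integer. Then for every $1\le r\le l-1$ the column vector $b_r^{(1)}$ of numbers of brick-wall lattice paths of the first type ending in the column $x=r$ is given by $$b^{(1)}_r=\begin{cases}(M_LM_U)^{\rho}\,b_0, & r\text{ even},\\ M_U(M_LM_U)^{\rho}\,b_0, & r\text{ odd},\end{cases}\qquad \rho=\left\lfloor \frac r2\right\rfloor .$$ Hence the number of all brick-wall lattice paths of the first type connecting the left and right sides of the rectangle $\mathcal R$ with walks inside $\mathcal R$, which is the same as the number of such paths of the second type (so $\mathcal B^{(1)}_{l,w}=\mathcal B^{(2)}_{l,w}=:\mathcal B_{l,w}$), is $$\mathcal B_{l,w}=u\,b^{(1)}_{l-1},$$ where $u=(1,1,\dots,1)$ is the row matrix with $w$ components.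
   Context: A point $(a,b)\in\mathbf Z\times\mathbf Z$ is even (odd) if $|a|+|b|$ is even (odd). A brick-wall lattice path of the first type is a finite sequence of points of $\mathbf Z\times\mathbf Z$ in which each consecutive step is either the horizontal step $(1,0)$ (allowed from any point), or the step $(0,1)$ taken from an even point, or the step $(0,-1)$ taken from an odd point. A brick-wall lattice path of the second type is defined in the same way with the steps $(1,0)$ from any point, $(0,1)$ from an odd point, $(0,-1)$ from an even point. Paths visit no point more than once; the empty path (a single point) is allowed. Let $\mathcal R=[0,l-1]\times[0,w-1]$. For $t\in\{1,2\}$, $\mathcal B^{(t)}_{l,w}$ is the number of brick-wall lattice paths of type $t$ (type 1 = first, type 2 = second) starting at some point $(0,\alpha)$ and ending at some point $(l-1,\beta)$, with $\alpha,\beta\in\{0,\dots,w-1\}$, staying inside $\mathcal R$ and using no vertical step along the left side $x=0$ (vertical steps along the right side $x=l-1$ are allowed). For $0\le i\le l-1$, $0\le j\le w-1$, $b^{(t)}_{ij}$ is the number of such paths of type $t$ (inside $\mathcal R$, starting on the left side, no vertical step along $x=0$) ending at $(i,j)$, and $b^{(t)}_i$ is the column vector $(b^{(t)}_{i,w-1},b^{(t)}_{i,w-2},\dots,b^{(t)}_{i,1},b^{(t)}_{i,0})^T$. In particular $b^{(1)}_0=b^{(2)}_0=b_0$ is the all-ones column vector. Let $J=\begin{pmatrix}1&1\\1&1\end{pmatrix}$. For odd $w$, $M_U$ and $M_L$ are the $w\times w$ block-diagonal matrices $M_U=\mathrm{diag}(J,J,\dots,J,1)$ and $M_L=\mathrm{diag}(1,J,\dots,J,J)$,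 each with $(w-1)/2$ blocks $J$ and one $1\times1$ block $(1)$. *)

(* Defs.v *)
From HB Require Import structures.
From mathcomp Require Import all_boot all_order all_algebra.
From mathcomp Require Import finmap.
From mathcomp Require Import boolp classical_sets functions cardinality.

Set Implicit Arguments.
Unset Strict Implicit.
Unset Printing Implicit Defensive.

Import Order.TTheory GRing.Theory Num.Theory.

Local Open Scope classical_set_scope.
Local Open Scope ring_scope.

Definition point : Type := (int * int)%type.

Definition odd_point (a : point) : bool := odd (`|a.1|%N + `|a.2|%N).
Definition even_point (a : point) : bool := ~~ odd_point a.

Variant bw_type := first_type | second_type.

Definition bw_step (t : bw_type) (a b : point) : bool :=
  match t with
  | first_type =>
      [|| b == (a.1 + 1, a.2),
          even_point a && (b == (a.1, a.2 + 1)) |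
          odd_point a && (b == (a.1, a.2 - 1))]
  | second_type =>
      [|| b == (a.1 + 1, a.2),
          odd_point a && (b == (a.1, a.2 + 1)) |
          even_point a && (b == (a.1, a.2 - 1))]
  end.

(* A path is the sequence of the points it visits, so the empty path at [a] is
   [:: a], and the empty sequence is not a path. *)
Definition bw_path (t : bw_type) (s : seq point) : bool :=
  [&& s != [::], sorted (bw_step t) s & uniq s].

Definition path_start (s : seq point) : point := head (0, 0) s.
Definition path_end (s : seq point) : point := last (0, 0) s.

Definition in_rect (l w : nat) (a : point) : bool :=
  (0 <= a.1 <= l%:Z - 1) && (0 <= a.2 <= w%:Z - 1).

(* Two consecutive points of a path both have abscissa 0 exactly when the step
   between them is a vertical step along the line x = 0. *)
Definition no_left_vertical (s : seq point) : bool :=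
  sorted [rel a b : point | ~~ ((a.1 == 0) && (b.1 == 0))] s.

Definition left_path (t : bw_type) (l w : nat) (s : seq point) : bool :=
  [&& bw_path t s, all (in_rect l w) s, (path_start s).1 == 0
    & no_left_vertical s].

Definition paths_to (t : bw_type) (l w : nat) (e : point) : set (seq point) :=
  [set s | left_path t l w s && (path_end s == e)].

Definition paths_across (t : bw_type) (l w : nat) : set (seq point) :=
  [set s | left_path t l w s && ((path_end s).1 == l%:Z - 1)].

(* The counts below use [fset_set], which is only meaningful on finite sets. *)
Lemma finite_left_path (t : bw_type) (l w : nat) :
  finite_set [set s | left_path t l w s].
Proof.
pose L : seq point := [seq (i%:Z, j%:Z) | i <- iota 0 l, j <- iota 0 w].
pose X := [set s : seq point | all (mem L) s /\ (size s <= size L)%N].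
have finX n : finite_set [set s : seq point | all (mem L) s /\ (size s <= n)%N].
  elim: n => [|n IHn].
    apply: (sub_finite_set _ (finite_set1 [::])) => s /= [_].
    by rewrite leqn0 => /nilP.
  have fL : finite_set [set` L] by exact: finite_seq.
  have fC := finite_image2 (@cons point) fL IHn.
  have f0 : finite_set [set ([::] : seq point)] by exact: finite_set1.
  have fU : finite_set ([set ([::] : seq point)] `|`
     [set a :: s | a in [set` L] & s in
        [set s : seq point | all (mem L) s /\ (size s <= n)%N]]).
    by rewrite finite_setU.
  apply: sub_finite_set fU => -[|a s] /= [+ sn]; first by left.
  by case/andP=> aL sL; right; exists a => //; exists s.
apply: (sub_finite_set _ (finX (size L))) => s /=.
case/and4P=> /and3P[_ _ us] sR _ _.
have sL : {subset s <= L}.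
  move=> [x y] /(allP sR) /andP[/= /andP[x0 x1] /andP[y0 y1]].
  case: x x0 x1 => [x|//] _ x1; case: y y0 y1 => [y|//] _ y1.
  apply/allpairsP; exists (x, y) => /=; split=> //; rewrite mem_iota add0n /=.
    by move: x1; rewrite lerBrDr -PoszD lez_nat addn1.
  by move: y1; rewrite lerBrDr -PoszD lez_nat addn1.
by split; [apply/allP | exact: uniq_leq_size].
Qed.

Definition bnum (t : bw_type) (l w i j : nat) : nat :=
  #|` fset_set (paths_to t l w (i%:Z, j%:Z))|.

(* Entries are listed from the highest point of the column x = i (ordinate
   w - 1) down to ordinate 0, hence [rev_ord]. *)
Definition bvec (t : bw_type) (l w i : nat) : 'cV[nat]_w :=
  \col_(k < w) bnum t l w i (rev_ord k).

Definition Bnum (t : bw_type) (l w : nat) : nat :=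
  #|` fset_set (paths_across t l w)|.

Definition b0 (w : nat) : 'cV[nat]_w := const_mx 1.

Lemma bvec0 (t : bw_type) (l w : nat) : (0 < l)%N -> bvec t l w 0 = b0 w.
Proof.
move=> l0; apply/matrixP => k z; rewrite !mxE /bnum.
move: (rev_ord k) => j.
rewrite (_ : paths_to _ _ _ _ = [set [:: (0%:Z, j%:Z)]]).
  by rewrite fset_set1 cardfs1.
apply/seteqP; split=> s; last first.
  move=> ->; rewrite /paths_to /= /left_path /bw_path /in_rect /no_left_vertical.
  rewrite /path_end /path_start /= eqxx !andbT /=.
  by rewrite !lerBrDr -!PoszD !lez_nat !addn1 l0 ltn_ord.
rewrite /paths_to /= => /andP[/and4P[/and3P[s0 ps us] sR st nv] /eqP se].
have mono (a : point) p : path (bw_step t) a p -> (a.1 <= (last a p).1)%R.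
  elim: p a => [//|b p IHp] a /= /andP[ab /IHp]; apply: le_trans.
  by case: t {ps IHp} ab => /or3P[|/andP[_]|/andP[_]] /eqP-> //=; rewrite lerDl.
case: s s0 ps us sR st nv se => [//|a [|b p]] _.
  by rewrite /path_end /= => _ _ _ _ _ ->.
rewrite /path_end /path_start /no_left_vertical /=.
move=> /andP[_ /mono bl] _ /and3P[_ /andP[/andP[b0 _] _] _] /eqP a0.
move=> /andP[+ _] le.
by rewrite le /= in bl; rewrite a0 eqxx eq_le bl b0.
Qed.

Definition J : 'M[nat]_2 := const_mx 1.

Fixpoint diagJ (m : nat) : 'M[nat]_(m.*2) :=
  match m with
  | 0 => 0
  | m'.+1 => (block_mx J 0 0 (diagJ m') : 'M_(2 + m'.*2))
  end.

Lemma odd_dimU (w : nat) : odd w -> (w./2.*2 + 1 = w)%N.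
Proof. by move=> w_odd; rewrite addn1 -[RHS]odd_double_half w_odd. Qed.

Lemma odd_dimL (w : nat) : odd w -> (1 + w./2.*2 = w)%N.
Proof. by move=> w_odd; rewrite addnC odd_dimU. Qed.

(* diag(J, ..., J, 1) and diag(1, J, ..., J); for odd w, w./2 = (w - 1) / 2. *)
Definition M_U (w : nat) (w_odd : odd w) : 'M[nat]_w :=
  castmx (odd_dimU w_odd, odd_dimU w_odd) (block_mx (diagJ w./2) 0 0 1%:M).
Definition M_L (w : nat) (w_odd : odd w) : 'M[nat]_w :=
  castmx (odd_dimL w_odd, odd_dimL w_odd) (block_mx 1%:M 0 0 (diagJ w./2)).

(* Main.v *)
From mathcomp Require Import all_boot all_order all_algebra.
From mathcomp Require Import finmap.
From mathcomp Require Import classical_sets cardinality.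
From mathcomp Require Import zify.
Require Import Defs.

Set Implicit Arguments.
Unset Strict Implicit.
Unset Printing Implicit Defensive.

Import Order.TTheory GRing.Theory Num.Theory.
Local Open Scope ring_scope.

(** A vertical step always joins a point to its [partner], the neighbour in the
same column determined by the parity, and partners are mutual; so a path makes
at most one vertical step in each column.  A path ending at [e], off the left
side, therefore reaches [e] either by a horizontal step from the left neighbour
of [e], or by a horizontal step into the partner of [e] followed by a vertical
one.  This is a linear recurrence from one column to the next, and as partners
alternate with the parity of the column its matrix alternates between [M_U] and
[M_L].  Since [w] is odd, the reflection [y |-> w - 1 - y] preserves the parity of
points and reverses vertical steps, so it exchanges the two types of paths. *)

(** * Cardinalities of images, disjoint unions and fibres *)

Lemma card_fset_set_image_inj (T U : choiceType) (f : T -> U) (A : set T) :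
  injective f -> finite_set A ->
  #|` fset_set (f @` A)%classic| = #|` fset_set A|.
Proof. by move=> f_inj fA; rewrite fset_set_image // card_imfset. Qed.

Lemma card_fset_set_setU (T : choiceType) (A B : set T) :
  finite_set A -> finite_set B -> (forall x, A x -> B x -> False) ->
  #|` fset_set (A `|` B)%classic| = (#|` fset_set A| + #|` fset_set B|)%N.
Proof.
move=> fA fB AB; rewrite fset_setU // cardfsU -fset_setI //.
rewrite (_ : (A `&` B)%classic = set0) ?fset_set0 ?cardfs0 ?subn0 //.
by apply/seteqP; split=> // x [Ax Bx]; apply: AB Ax Bx.
Qed.

(** The [B j] are the fibres of [h] on [A], hence pairwise disjoint, and those with [j < w] cover
    [A]. *)
Lemma card_fset_set_fibres (T : choiceType) (A : set T) (w : nat)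
    (B : nat -> set T) (h : T -> nat) :
  finite_set A -> (forall j, finite_set (B j)) ->
  (forall x, A x -> (h x < w)%N) ->
  (forall j x, B j x <-> A x /\ h x = j) ->
  #|` fset_set A| = (\sum_(j < w) #|` fset_set (B j)|)%N.
Proof.
move=> fA fB hw BE; rewrite trivIset_sum_card //; last first.
  by move=> i j _ _ [x [/BE[_ <-] /BE[_ <-]]].
congr (#|` fset_set _|); rewrite -bigcup_mkord; apply/seteqP; split=> x.
  by move=> Ax; exists (h x); [exact: hw | apply/BE].
by case=> j _ /BE[].
Qed.

(** * Steps and partners *)

Definition left_shift (a : point) : point := (a.1 - 1, a.2).

Definition partner (t : bw_type) (a : point) : point :=
  (a.1, if match t with first_type => odd_point a
                   | second_type => even_point a end
        then a.2 - 1 else a.2 + 1).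

Lemma bw_stepE (t : bw_type) (a b : point) :
  bw_step t a b = (b == (a.1 + 1, a.2)) || (b == partner t a).
Proof.
by case: t; rewrite /bw_step /partner /even_point; case: (odd_point a) => /=;
   rewrite ?orbF.
Qed.

Lemma odd_pointD1 (x y : int) : odd_point (x, y + 1) = ~~ odd_point (x, y).
Proof. rewrite /odd_point /=; lia. Qed.

Lemma odd_pointB1 (x y : int) : odd_point (x, y - 1) = ~~ odd_point (x, y).
Proof. by rewrite -{2}[y](subrK 1) odd_pointD1 negbK. Qed.

(** Partners have opposite parities, so the vertical step allowed at one undoes the vertical step
    allowed at the other. *)
Lemma partnerK (t : bw_type) : involutive (partner t).
Proof.
case=> x y; rewrite /partner /even_point /=.
by case: t; case xy: (odd_point (x, y));
   rewrite /= ?odd_pointD1 ?odd_pointB1 xy /= ?addrK ?subrK.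
Qed.

Lemma partner_neq (t : bw_type) (a : point) : partner t a != a.
Proof. by case: a => x y; rewrite /partner xpair_eqE /=; case: ifP => _; lia. Qed.

(** * Endpoints and extensions of paths *)

Lemma bw_path_abscissa (t : bw_type) (s : seq point) (a : point) :
  sorted (bw_step t) s -> a \in s -> a.1 <= (path_end s).1.
Proof.
elim/last_ind: s a => [//|s b IHs] a; rewrite /path_end last_rcons.
rewrite mem_rcons inE; case: s IHs => [|c s] IHs /=.
  by rewrite orbF => _ /eqP->.
rewrite rcons_path bw_stepE => /andP[ps ab] /orP[/eqP->//|/(IHs _ ps) le].
by apply: le_trans le _; case/orP: ab => /eqP-> //=; rewrite lerDl.
Qed.

(** Off the left side, [e] can neither start a left path, which rules out empty [s], nor be reached
    by a vertical step along x = 0. *)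
Lemma left_path_rcons (t : bw_type) (l w : nat) (s : seq point) (e : point) :
  e.1 != 0 ->
  left_path t l w (rcons s e) =
    [&& left_path t l w s, bw_step t (path_end s) e, e \notin s & in_rect l w e].
Proof.
move=> /negPf e0; rewrite /left_path /bw_path /no_left_vertical.
case: s => [|a s] /=; first by rewrite /path_start /= e0 !andbF.
rewrite !rcons_path /= e0 andbF /= andbT all_rcons rcons_uniq mem_rcons !inE.
rewrite /path_end /path_start /= [a == e]eq_sym !negb_or.
do !case: (path _ _ _) => //=; case: (e == a) => //=; rewrite ?andbF //.
by case: (e \in s); case: (a \in s); case: (uniq s); case: (in_rect l w a);
  case: (in_rect l w e); case: (all _ s); case: (a.1 == 0);
  case: (bw_step _ _ _).
Qed.

Lemma finite_paths_to (t : bw_type) (l w : nat) (e : point) :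
  finite_set (paths_to t l w e).
Proof. by apply: sub_finite_set (finite_left_path t l w) => s /= /andP[]. Qed.

Lemma path_end_mem (s : seq point) : s != [::] -> path_end s \in s.
Proof. by case: s => // a s _; exact: (mem_last a s). Qed.

Lemma left_path_neq0 t l w s : left_path t l w s -> s != [::].
Proof. by case/and4P => /and3P[]. Qed.

Lemma left_path_end_in_rect t l w s :
  left_path t l w s -> in_rect l w (path_end s).
Proof.
move=> ps; have /and4P[_ /allP sR _ _] := ps.
exact/sR/path_end_mem/(left_path_neq0 ps).
Qed.

Lemma left_path_abscissa t l w s a :
  left_path t l w s -> a \in s -> a.1 <= (path_end s).1.
Proof. by case/and4P => /and3P[_ + _] _ _ _; exact: bw_path_abscissa. Qed.

(** * The recurrence between neighbouring columns *)

Lemma paths_toS (t : bw_type) (l w : nat) (e : point) :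
  in_rect l w e -> e.1 != 0 ->
  paths_to t l w e =
    ([set rcons s e | s in paths_to t l w (left_shift e)] `|`
     [set rcons (rcons s (partner t e)) e
       | s in paths_to t l w (left_shift (partner t e))])%classic.
Proof.
move=> eR e0; set p := partner t e.
have p0 : p.1 != 0 by [].
have shiftE (a : point) : ((left_shift a).1 + 1, (left_shift a).2) = a.
  by case: a => x y; rewrite /= subrK.
have shift_inj (a b : point) : a = (b.1 + 1, b.2) -> b = left_shift a.
  by case: b => x y ->; rewrite /left_shift /= addrK.
(* Abscissas never decrease along a path, so one that ends a column to the left of [a] has not yet
   met the column of [a]. *)
have fresh s a b : left_path t l w s -> path_end s = left_shift a ->
    b.1 = a.1 -> b \notin s.
  move=> ps es ba; apply/negP => /(left_path_abscissa ps); rewrite es /= ba.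
  by rewrite lerBrDr gerDl.
apply/seteqP; split=> s; last first.
  case=> -[s' /= /andP[ps' /eqP es'] <-];
    rewrite /paths_to /= /path_end last_rcons eqxx.
    rewrite andbT left_path_rcons // ps' bw_stepE es' shiftE eqxx eR.
    by rewrite (fresh _ e).
  (* The ordinate of [p] is in range because it is that of the end of [s']; its abscissa is that of
     [e]. *)
  have pR : in_rect l w p.
    have := left_path_end_in_rect ps'; rewrite es' /in_rect /= => /andP[_ ->].
    by case/andP: eR => ->.
  rewrite andbT !left_path_rcons // ps' bw_stepE es' shiftE eqxx pR eR.
  rewrite (fresh _ p) //= /path_end last_rcons bw_stepE partnerK eqxx orbT.
  rewrite mem_rcons inE negb_or eq_sym partner_neq.
  by rewrite (fresh _ p).
rewrite /paths_to /= => /andP[ps /eqP se].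
case/lastP: s ps se => [/left_path_neq0//|s a] ps.
rewrite /path_end last_rcons => ea; move: ps; rewrite {}ea left_path_rcons //.
case/and4P=> ps; rewrite bw_stepE => /orP[/eqP es|/eqP es] eNs _.
  by left; exists s => //; rewrite /= ps; exact/eqP/shift_inj.
have {es} sp : path_end s = p by rewrite /p es partnerK.
case/lastP: s ps sp eNs => [/left_path_neq0//|s b] ps.
rewrite /path_end last_rcons => bp; move: ps; rewrite {}bp left_path_rcons //.
case/and4P=> ps; rewrite bw_stepE => /orP[/eqP es|/eqP es] pNs _ eNs.
  by right; exists s => //; rewrite /= ps; exact/eqP/shift_inj.
(* Two vertical steps in a row would start and end at [e], which a path cannot visit twice. *)
case/negP: eNs; rewrite mem_rcons inE; apply/orP; right.
by rewrite -[e](partnerK t) -/p es partnerK path_end_mem ?(left_path_neq0 ps).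
Qed.

(** Integer coordinates, unlike those of [bnum], leave room for a partner at ordinate -1 or w. *)
Definition path_count (t : bw_type) (l w : nat) (e : point) : nat :=
  #|` fset_set (paths_to t l w e)|.

Lemma path_countS (t : bw_type) (l w : nat) (e : point) :
  in_rect l w e -> e.1 != 0 ->
  path_count t l w e = (path_count t l w (left_shift e)
                        + path_count t l w (left_shift (partner t e)))%N.
Proof.
move=> eR e0; rewrite /path_count paths_toS // card_fset_set_setU.
- have inj2 : injective (fun s => rcons (rcons s (partner t e)) e).
    exact: inj_comp (@rcons_injl _ e) (@rcons_injl _ (partner t e)).
  rewrite (card_fset_set_image_inj (@rcons_injl _ e));
    last exact: finite_paths_to.
  by rewrite (card_fset_set_image_inj inj2) //; exact: finite_paths_to.
- exact/finite_image/finite_paths_to.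
- exact/finite_image/finite_paths_to.
(* In a common element, the point before [e] would lie both one column to the left of [e] and, as
   its partner, in the same column. *)
move=> _ [s1 /andP[_ /eqP es1] <-] [s2 _ s12].
have {}s12 : rcons s2 (partner t e) = s1 by exact: rcons_injl s12.
move: es1; rewrite -s12 /path_end last_rcons => /(congr1 fst) /=.
by lia.
Qed.

(** Removes the second term of the recurrence when the partner leaves the rectangle; this accounts
    for the block of size 1 in [M_U] and [M_L]. *)
Lemma path_count_out (t : bw_type) (l w : nat) (e : point) :
  ~~ in_rect l w e -> path_count t l w e = 0%N.
Proof.
move=> eR; rewrite /path_count (_ : paths_to _ _ _ _ = set0).
  by rewrite fset_set0 cardfs0.
apply/seteqP; split=> // s /andP[/left_path_end_in_rect + /eqP se].
by rewrite se (negPf eR).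
Qed.

(** * Reflection and the two types of paths *)

Definition other_type (t : bw_type) : bw_type :=
  match t with first_type => second_type | second_type => first_type end.

Definition reflect_point (w : nat) (a : point) : point := (a.1, w%:Z - 1 - a.2).

Lemma reflect_pointK (w : nat) : involutive (reflect_point w).
Proof. by case=> x y; rewrite /reflect_point /= subKr. Qed.

Lemma odd_reflect_point (w : nat) (a : point) :
  odd w -> odd_point (reflect_point w a) = odd_point a.
Proof. by case: a => x y; rewrite /odd_point /= => w_odd; lia. Qed.

Lemma bw_step_reflect (t : bw_type) (w : nat) (a b : point) :
  odd w ->
  bw_step (other_type t) (reflect_point w a) (reflect_point w b) = bw_step t a b.
Proof.
move=> w_odd; case: t; rewrite /bw_step /even_point odd_reflect_point //;
  case: a b => x y [x' y'] /=; rewrite !xpair_eqE;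
  case: (odd_point _) => /=; lia.
Qed.

Lemma path_end_reflect (w : nat) (s : seq point) :
  s != [::] -> path_end (map (reflect_point w) s) = reflect_point w (path_end s).
Proof. by case: s => // a s _; rewrite /path_end /= last_map. Qed.

Lemma left_path_reflect (t : bw_type) (l w : nat) (s : seq point) :
  odd w -> left_path t l w s ->
  left_path (other_type t) l w (map (reflect_point w) s).
Proof.
move=> w_odd /and4P[/and3P[s0 ps us] sR st nv].
apply/and4P; split.
- apply/and3P; split; first by case: s s0 {ps us sR st nv}.
    by rewrite sorted_map (eq_sorted (e' := bw_step t)) // => a b /=;
      exact: bw_step_reflect.
  by rewrite (map_inj_uniq (inv_inj (@reflect_pointK w))).
- rewrite all_map; apply: sub_all sR => -[x y]; rewrite /in_rect /=; lia.
- by case: s s0 st {ps us sR nv}.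
by rewrite /no_left_vertical sorted_map.
Qed.

Lemma Bnum_other_type (t : bw_type) (l w : nat) :
  odd w -> Bnum (other_type t) l w = Bnum t l w.
Proof.
move=> w_odd; rewrite /Bnum.
have reflE t' s : paths_across t' l w s ->
    paths_across (other_type t') l w (map (reflect_point w) s).
  case/andP=> ps se; apply/andP; split; first exact: left_path_reflect.
  by rewrite path_end_reflect ?(left_path_neq0 ps).
have reflK := mapK (@reflect_pointK w).
rewrite -(card_fset_set_image_inj (can_inj reflK) (A := paths_across t l w)).
  congr (#|` fset_set _|); apply/seteqP; split=> s; last first.
    by case=> s' /reflE ps' <-.
  move/reflE => ps; exists (map (reflect_point w) s); last exact: reflK.
  by case: t ps.
by apply: sub_finite_set (finite_left_path t l w) => s /andP[].
Qed.

(** * Crossing paths sorted by endpoint *)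

Lemma Bnum_sum (t : bw_type) (l w : nat) :
  (0 < l)%N -> Bnum t l w = (\sum_(j < w) bnum t l w (l - 1) j)%N.
Proof.
move=> l_gt0; have l1 : (l - 1)%N%:Z = l%:Z - 1 by lia.
(* Ordinates in the rectangle are nonnegative, so the absolute value loses nothing. *)
apply: (card_fset_set_fibres (h := fun s => `|(path_end s).2|%N)
          (B := fun j => paths_to t l w ((l - 1)%N%:Z, j%:Z))).
- by apply: sub_finite_set (finite_left_path t l w) => s /andP[].
- by move=> j; exact: finite_paths_to.
- move=> s /andP[/left_path_end_in_rect + _]; rewrite /in_rect; lia.
move=> j s; split.
  by case/andP=> ps /eqP se; rewrite /paths_across /= ps se /= l1 eqxx.
case=> /andP[ps /eqP se] <-; rewrite /paths_to /= ps /=.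
rewrite [path_end s]surjective_pairing se l1 xpair_eqE eqxx /=.
have := left_path_end_in_rect ps; rewrite /in_rect; lia.
Qed.

(** * Entries of the matrices *)

Lemma diagJE (m : nat) (i j : 'I_(m.*2)) : diagJ m i j = (i./2 == j./2)%N.
Proof.
elim: m i j => [[]//|m IHm] i j /=.
rewrite !mxE; case: splitP => i' ii; rewrite !mxE; case: splitP => j' jj;
  rewrite ?mxE ?IHm ii jj.
- by case: i' j' {ii jj} => [[|[|//]] ?] [[|[|//]] ?].
- by case: i' {ii} => [[|[|//]] ?].
- by case: j' {jj} => [[|[|//]] ?].
- by [].
Qed.

Lemma half_eq (m n : nat) :
  ((m./2 == n./2)%N : nat) =
  ((n == m) + (n%:Z == if odd m then m%:Z - 1 else m%:Z + 1)%R)%N.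
Proof.
have := odd_double_half m; have := odd_double_half n.
case: (odd m); case: (odd n); lia.
Qed.

(** The classes of [uphalf] are {0}, {1,2}, {3,4}, and so on. Comparing in [int] matters at [m = 0],
    where the second candidate is -1 and matches no [n]. *)
Lemma uphalf_eq (m n : nat) :
  ((uphalf m == uphalf n)%N : nat) =
   ((n == m) + (n%:Z == if odd m then m%:Z + 1 else m%:Z - 1)%R)%N.
Proof.
rewrite !uphalf_half.
have := odd_double_half m; have := odd_double_half n.
case: (odd m); case: (odd n); lia.
Qed.

(** At most one index contributes; for [y] out of range none does, which agrees with the assumed
    value 0. *)
Lemma sum_rev_ord_eq (w : nat) (f : int -> nat) (y : int) :
  (~~ (0 <= y <= w%:Z - 1) -> f y = 0%N) ->
  (\sum_(k < w) ((rev_ord k)%:Z == y)%R * f (rev_ord k)%:Z)%N = f y.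
Proof.
move=> f0; have [yw|/f0 fy] := boolP (0 <= y <= w%:Z - 1).
  case: y yw f0 => [y|//] yw _; have y_lt : (y < w)%N by lia.
  rewrite (bigD1 (rev_ord (Ordinal y_lt))) //= subnSK // subKn 1?ltnW //.
  rewrite eqxx mul1n big1 ?addn0 // => k kE; apply/eqP; rewrite muln_eq0 eqb0.
  apply/orP; left; apply: contra kE => /eqP[kE]; apply/eqP/val_inj => /=.
  by have := ltn_ord k; lia.
rewrite fy big1 // => k _; have [kE|] := eqVneq; last by rewrite mul0n.
by rewrite kE fy muln0.
Qed.

(** The last index w - 1 is even, so it shares its half with no smaller index and forms the final
    block of size 1. *)
Lemma M_UE (w : nat) (w_odd : odd w) (i j : 'I_w) :
  M_U w_odd i j = (i./2 == j./2)%N.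
Proof.
have wE := odd_dimU w_odd.
rewrite castmxE !mxE; case: splitP => i' /= ii; rewrite !mxE;
  case: splitP => j' /= jj; rewrite ?mxE ?diagJE ?ii ?jj //.
- have := ltn_ord i'; lia.
- have := ltn_ord j'; lia.
by rewrite !ord1 !eqxx.
Qed.

Lemma M_LE (w : nat) (w_odd : odd w) (i j : 'I_w) :
  M_L w_odd i j = (uphalf i == uphalf j)%N.
Proof.
have wE := odd_dimL w_odd.
rewrite castmxE !mxE; case: splitP => i' /= ii; rewrite !mxE;
  case: splitP => j' /= jj; rewrite ?mxE ?diagJE ?ii ?jj //.
- by rewrite !ord1.
- by rewrite ord1.
by rewrite ord1.
Qed.

(** * The recurrence in matrix form *)

Lemma bvecS (l w r : nat) (w_odd : odd w) :
  (r.+1 < l)%N ->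
  bvec first_type l w r.+1 =
    (if odd r then M_L w_odd else M_U w_odd) *m bvec first_type l w r.
Proof.
move=> r_lt; apply/matrixP => k z; rewrite !mxE.
pose f y := path_count first_type l w (r%:Z, y).
have f0 y : ~~ (0 <= y <= w%:Z - 1) -> f y = 0%N.
  by move=> yw; apply: path_count_out; rewrite /in_rect /= (negPf yw) andbF.
pose e : point := (r.+1%:Z, (rev_ord k)%:Z).
pose y' := (partner first_type e).2.
transitivity (f (rev_ord k)%:Z + f y')%N.
  have eR : in_rect l w e by rewrite /in_rect /=; have := ltn_ord k; lia.
  rewrite [LHS](path_countS _ eR) //.
  by rewrite /left_shift /= (_ : r.+1%:Z - 1 = r%:Z) //; lia.
(* Both terms become sums over the entries of column [r], whose indicators add up to the matrix
   coefficient. *)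
rewrite -(sum_rev_ord_eq (f0 _)) -(sum_rev_ord_eq (f0 y')) -big_split /=.
apply: eq_bigr => k' _; rewrite mxE -mulnDl; congr (_ * _)%N.
rewrite /y' /partner /e /odd_point /=.
have k_lt := ltn_ord k; have k'_lt := ltn_ord k'.
(* As [w] is odd, index [k] and its ordinate w - 1 - k have the same parity; the parity of [r] then
   decides whether [k] is paired as in [M_U] or as in [M_L]. *)
rewrite oddD (_ : odd (w - k.+1) = odd k); last by lia.
by case: (odd r); rewrite ?M_LE ?M_UE ?half_eq ?uphalf_eq; case: (odd k) => /=;
   congr (_ + _)%N; lia.
Qed.

Theorem theorem2p3 (l w : nat) (l_ge2 : (2 <= l)%N) (w_ge2 : (2 <= w)%N)
    (w_odd : odd w) :
  (forall r : nat, (1 <= r <= l - 1)%N ->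
     bvec first_type l w r =
       if odd r
       then M_U w_odd *m (M_L w_odd *m M_U w_odd) ^+ (r %/ 2)%N *m b0 w
       else (M_L w_odd *m M_U w_odd) ^+ (r %/ 2)%N *m b0 w)
  /\ Bnum first_type l w = Bnum second_type l w
  /\ Bnum first_type l w
       = ((const_mx 1 : 'rV[nat]_w) *m bvec first_type l w (l - 1)%N) 0 0.
Proof.
split; last split.
- move=> r /andP[_]; elim: r => [_|r IHr r_lt].
    by rewrite bvec0 ?mul1mx //; lia.
  rewrite bvecS; last by lia.
  rewrite IHr; last by lia.
  (* The exponent grows only when [r] is odd: the new factor [M_L] then joins the leading [M_U] to
     complete one more product. *)
  rewrite oddS !divn2 -uphalfE uphalf_half.
  by case: (odd r) => /=; rewrite ?add0n ?add1n ?exprS !mulmxA.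
- exact: (Bnum_other_type second_type l w_odd).
rewrite Bnum_sum; last by lia.
rewrite !mxE (reindex_inj rev_ord_inj); apply: eq_bigr => k _.
by rewrite !mxE mul1r.
Qed.
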